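(* Let $Q\subseteq\mathbb{R}^n$ be a compact metric space and consider the system of linear equations $$A(x)\phi(x)=\gamma(x),\quad x\in Q,$$ where $A:Q\to M_{r,s}(\mathbb{R})$ and $\gamma:Q\to\mathbb{R}^r$ are continuous and semialgebraic. Let $p:Q\to\mathbb{R}^s$ be the projection of a solution of the system on $\mathrm{Ker}A(x)^{\perp}$, i.e. $p(x)=\Pi_{\mathrm{Ker}A(x)^\perp}\phi_1(x)$ for a solution $\phi_1:Q\to\mathbb{R}^s$ of the system. Assume that for every given $x\in Q$ there exists $v_x\in\widetilde H^{\mathrm{Gl}}_x$ such that $B(x,r_{v_x})\ni y\mapsto\gamma_{v_x}(y)=\Pi_{H^{(0)}_y}v_x$ is discontinuous, at most, at isolated points (which is the same as saying that $p$ and $B(x,r_{v_x})\ni y\mapsto\Pi_{\mathrm{Ker}A(y)^\perp}v_x$ are discontinuous at most at isolated points for every given $x\in Q$). Then the following conditions are equivalent: (i) The system has a continuous and semialgebraic solution. (ii) $\widetilde{\mathcal H}^{\mathrm{Gl}}$ has no empty fiber. (iii) The Glaeser-stable refinement $\mathcal H^{\mathrm{Gl}}$ associated with the system has no empty fibers and $p$ is semialgebraic. (iv) The system has a continuous solution and a semialgebraic one (they may possibly be different).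
   Context: $M_{r,s}(\mathbb{R})$ is the set of real $r\times s$ matrices; all $\mathbb{R}^m$ carry the Euclidean norm, $Q$ carries the Euclidean metric, and $B(x,r)$ denotes the Euclidean ball in $Q$, $B(x,r)=\{y\in Q:\|y-x\|<r\}$. A function is semialgebraic if its graph is a semialgebraic set. A solution of the system is a map $\phi:Q\to\mathbb{R}^s$ with $A(x)\phi(x)=\gamma(x)$ for all $x\in Q$ (no regularity required unless stated). For a (nonempty) affine subspace $V\subseteq\mathbb{R}^s$ and $w\in\mathbb{R}^s$, $\Pi_V w$ is the point of $V$ closest to $w$ in Euclidean norm. The empty set and $\mathbb{R}^s$ are allowed as affine subspaces of $\mathbb{R}^s$. (The function $p$ does not depend on the choice of the solution $\phi_1$.) A singular affine bundle (bundle) is a family $\mathcal H=(H_x)_{x\in Q}$ of affine subspaces $H_x\subseteq\mathbb{R}^s$, called fibers. The bundle associated with the system is $\mathcal H=\mathcal H^{(0)}$ with fibers $H_x=H^{(0)}_x=\{\lambda\in\mathbb{R}^s: A(x)\lambda=\gamma(x)\}$. The Glaeser refinement of a bundle $(H_x)_{x\in Q}$ is the bundle with fibers $\{v\in H_x:\ \mathrm{dist}(v,H_y)\to 0 \text{ as } y\to x,\ y\in Q\}$ (with $\mathrm{dist}(v,\emptyset)=+\infty$). $\mathcal H^{(k+1)}$ is the Glaeser refinement of $\mathcal H^{(k)}$; this sequence stabilizes after finitely many steps, and the stable bundle is the Glaeser-stable refinement $\mathcal H^{\mathrm{Gl}}=(H^{\mathrm{Gl}}_x)_{x\in Q}$.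 The semialgebraic Glaeser-stable bundle associated with the system is $\widetilde{\mathcal H}^{\mathrm{Gl}}=(\widetilde H^{\mathrm{Gl}}_x)_{x\in Q}$, where $$\widetilde H^{\mathrm{Gl}}_x=\{v\in H^{\mathrm{Gl}}_x:\ \exists\, r_v>0 \text{ such that } B(x,r_v)\ni y\mapsto\gamma_v(y)=\Pi_{H^{(0)}_y}v \text{ is semialgebraic}\}.$$ For $v_x\in\widetilde H^{\mathrm{Gl}}_x$, $r_{v_x}>0$ denotes a radius as in this definition. ''Discontinuous at most at isolated points'' means that every point of the set of discontinuities is an isolated point of that set. *)

(* Defs.v *)
From mathcomp Require Import all_boot all_order all_algebra.
From mathcomp Require Import all_classical all_reals all_analysis.
From mathcomp Require mpoly.

Set Implicit Arguments.
Unset Strict Implicit.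
Unset Printing Implicit Defensive.

Import Order.TTheory GRing.Theory Num.Theory.
Import numFieldNormedType.Exports.

Local Open Scope classical_set_scope.
Local Open Scope ring_scope.

(* R^m is 'cV[R]_m. The norm that MathComp-Analysis puts on matrices is the sup
   norm, so the Euclidean one is introduced here; both induce the library
   topology, in which limits, continuity and compactness are stated. *)
Definition enorm (R : realType) (m : nat) (u : 'cV[R]_m) : R :=
  Num.sqrt (\sum_i u i 0 ^+ 2).

Definition eball (R : realType) (n : nat) (Q : set 'cV[R]_n)
    (x : 'cV[R]_n) (r : R) : set 'cV[R]_n :=
  [set y | Q y /\ enorm (y - x) < r].

(* Equal to +oo when V is empty. *)
Definition edist_set (R : realType) (s : nat) (v : 'cV[R]_s)
    (V : set 'cV[R]_s) : \bar R :=
  ereal_inf [set (enorm (v - w))%:E | w in V].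

(* A junk value when V has no point closest to w, in particular when V is
   empty. *)
Definition closest_point (R : realType) (s : nat) (V : set 'cV[R]_s)
    (w : 'cV[R]_s) : 'cV[R]_s :=
  xget 0 [set u | V u /\ forall u', V u' -> enorm (w - u) <= enorm (w - u')].

Definition ker_orth (R : realType) (r s : nat) (M : 'M[R]_(r, s)) :
    set 'cV[R]_s :=
  [set w | forall u : 'cV[R]_s, M *m u = 0 -> \sum_i u i 0 * w i 0 = 0].

Inductive semialgebraic (R : realType) (n : nat) : set 'cV[R]_n -> Prop :=
| semialgebraic_pos (P : mpoly.mpoly n R) :
    semialgebraic [set x | 0 < mpoly.meval (fun i => x i 0) P]
| semialgebraicC (S : set 'cV[R]_n) : semialgebraic S -> semialgebraic (~` S)
| semialgebraicU (S T : set 'cV[R]_n) :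
    semialgebraic S -> semialgebraic T -> semialgebraic (S `|` T)
| semialgebraicI (S T : set 'cV[R]_n) :
    semialgebraic S -> semialgebraic T -> semialgebraic (S `&` T).

Definition semialgebraic_fun (R : realType) (n m : nat) (D : set 'cV[R]_n)
    (f : 'cV[R]_n -> 'cV[R]_m) : Prop :=
  semialgebraic [set col_mx x (f x) | x in D].

(* M_{r,s}(R) is identified with R^(r * s) through mxvec. *)
Definition semialgebraic_mxfun (R : realType) (n r s : nat)
    (D : set 'cV[R]_n) (A : 'cV[R]_n -> 'M[R]_(r, s)) : Prop :=
  semialgebraic_fun D (fun x => (mxvec (A x))^T).

Definition discontinuities (R : realType) (n m : nat) (D : set 'cV[R]_n)
    (f : 'cV[R]_n -> 'cV[R]_m) : set 'cV[R]_n :=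
  [set y | D y /\ ~ (f @ within D (nbhs y) --> f y)].

Definition discontinuous_at_most_at_isolated_points (R : realType) (n m : nat)
    (D : set 'cV[R]_n) (f : 'cV[R]_n -> 'cV[R]_m) : Prop :=
  discontinuities D f `<=` isolated (discontinuities D f).

Definition solution (R : realType) (n r s : nat) (Q : set 'cV[R]_n)
    (A : 'cV[R]_n -> 'M[R]_(r, s)) (gamma : 'cV[R]_n -> 'cV[R]_r)
    (phi : 'cV[R]_n -> 'cV[R]_s) : Prop :=
  forall x, Q x -> A x *m phi x = gamma x.

(* A bundle over Q is a family of fibers indexed by the ambient space; only the
   fibers over Q are ever used. *)
Definition system_bundle (R : realType) (n r s : nat)
    (A : 'cV[R]_n -> 'M[R]_(r, s)) (gamma : 'cV[R]_n -> 'cV[R]_r) :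
    'cV[R]_n -> set 'cV[R]_s :=
  fun x => [set lambda | A x *m lambda = gamma x].

Definition glaeser_refinement (R : realType) (n s : nat) (Q : set 'cV[R]_n)
    (H : 'cV[R]_n -> set 'cV[R]_s) : 'cV[R]_n -> set 'cV[R]_s :=
  fun x => [set v | H x v /\
    (fun y => edist_set v (H y)) @ within Q (nbhs x) --> 0%E].

Definition glaeser_iter (R : realType) (n s : nat) (Q : set 'cV[R]_n)
    (H : 'cV[R]_n -> set 'cV[R]_s) (k : nat) : 'cV[R]_n -> set 'cV[R]_s :=
  iter k (glaeser_refinement Q) H.

(* The fibers of the k-th refinement, for any k from which the sequence of
   refinements is stationary. *)
Definition glaeser_stable (R : realType) (n s : nat) (Q : set 'cV[R]_n)
    (H : 'cV[R]_n -> set 'cV[R]_s) : 'cV[R]_n -> set 'cV[R]_s :=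
  fun x => [set v | exists k,
    (forall l, (k <= l)%N -> forall y, Q y ->
       glaeser_iter Q H l y = glaeser_iter Q H k y) /\
    glaeser_iter Q H k x v].

Definition fiber_proj (R : realType) (n r s : nat)
    (A : 'cV[R]_n -> 'M[R]_(r, s)) (gamma : 'cV[R]_n -> 'cV[R]_r)
    (v : 'cV[R]_s) : 'cV[R]_n -> 'cV[R]_s :=
  fun y => closest_point (system_bundle A gamma y) v.

Definition semialgebraic_radius (R : realType) (n r s : nat)
    (Q : set 'cV[R]_n) (A : 'cV[R]_n -> 'M[R]_(r, s))
    (gamma : 'cV[R]_n -> 'cV[R]_r) (x : 'cV[R]_n) (v : 'cV[R]_s) (rv : R) :
    Prop :=
  0 < rv /\ semialgebraic_fun (eball Q x rv) (fiber_proj A gamma v).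

Definition semialgebraic_glaeser_stable (R : realType) (n r s : nat)
    (Q : set 'cV[R]_n) (A : 'cV[R]_n -> 'M[R]_(r, s))
    (gamma : 'cV[R]_n -> 'cV[R]_r) : 'cV[R]_n -> set 'cV[R]_s :=
  fun x => [set v | glaeser_stable Q (system_bundle A gamma) x v /\
    exists rv, semialgebraic_radius Q A gamma x v rv].

(* Main.v *)
(** The hypothesis already forces all four conditions. A point [v] of a stable
    fiber over [x] satisfies dist(v, H_y) -> 0, so [gamma_v] is continuous at
    [x]. By quantifier elimination the discontinuity set of a semialgebraic map
    is semialgebraic; if its points are isolated it is countable, hence so are
    its coordinate projections, and a countable semialgebraic subset of the line
    is finite. So [gamma_v] is continuous on a whole neighborhood of [x], and
    finitely many of these local solutions, glued with semialgebraic cutoffs,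
    give a continuous semialgebraic solution. Finally [p] is [gamma_0], whose
    graph is semialgebraic by quantifier elimination. *)
Require Import Defs.
From mathcomp Require Import all_boot all_order all_algebra.
From mathcomp Require Import all_classical all_reals all_analysis.
From mathcomp Require ordered_qelim qe_rcf polyrcf.
From mathcomp Require Import (canonicals, coercions) mpoly.
From mathcomp Require Import ring lra.
Import Order.TTheory GRing.Theory Num.Theory.
Import numFieldNormedType.Exports.

Local Open Scope classical_set_scope.
Local Open Scope ring_scope.

Set Implicit Arguments.
Unset Strict Implicit.
Unset Printing Implicit Defensive.

(** * Polynomial functions and maps on coordinate spaces *)

Section Polynomial_maps.
Context {R : realType}.

(** Polynomials enter only through the functions they define, so that polynomiality can be read off
    the shape of a function. *)
Definition polyfun (m : nat) (g : 'cV[R]_m -> R) : Prop :=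
  exists P : mpoly.mpoly m R, forall x, g x = mpoly.meval (fun i => x i 0) P.

Definition polymap (m k : nat) (g : 'cV[R]_m -> 'cV[R]_k) : Prop :=
  forall i, polyfun (fun x => g x i 0).

Lemma polyfun_cst m (c : R) : polyfun (fun _ : 'cV[R]_m => c).
Proof. by exists (mpoly.mpolyC m c) => x; rewrite mpoly.mevalC. Qed.

Lemma polyfun_coord m (i : 'I_m) : polyfun (fun x : 'cV[R]_m => x i 0).
Proof. by eexists => x; rewrite -(mpoly.mevalXU (fun i => x i 0) i). Qed.

Lemma polyfunD m (f g : 'cV[R]_m -> R) :
  polyfun f -> polyfun g -> polyfun (fun x => f x + g x).
Proof. by move=> [P fP] [S gS]; exists (P + S) => x; rewrite mpoly.mevalD fP gS. Qed.

Lemma polyfunM m (f g : 'cV[R]_m -> R) :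
  polyfun f -> polyfun g -> polyfun (fun x => f x * g x).
Proof. by move=> [P fP] [S gS]; exists (P * S) => x; rewrite mpoly.mevalM fP gS. Qed.

Lemma polyfunN m (f : 'cV[R]_m -> R) : polyfun f -> polyfun (fun x => - f x).
Proof. by move=> [P fP]; exists (- P) => x; rewrite mpoly.mevalN fP. Qed.

Lemma polyfunB m (f g : 'cV[R]_m -> R) :
  polyfun f -> polyfun g -> polyfun (fun x => f x - g x).
Proof. by move=> pf pg; apply: polyfunD pf (polyfunN pg). Qed.

Lemma polyfunX m (f : 'cV[R]_m -> R) k : polyfun f -> polyfun (fun x => f x ^+ k).
Proof.
move=> pf; elim: k => [|k IHk]; first exact: polyfun_cst.
by under eq_fun do rewrite exprS; exact: polyfunM.
Qed.

Lemma polyfun_sum m (I : Type) (s : seq I) (P : pred I) (f : I -> 'cV[R]_m -> R) :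
  (forall i, polyfun (f i)) -> polyfun (fun x => \sum_(i <- s | P i) f i x).
Proof.
move=> pf; elim: s => [|i s IHs].
  by under eq_fun do rewrite big_nil; exact: polyfun_cst.
under eq_fun do rewrite big_cons.
by case: (P i) => //; exact: polyfunD.
Qed.

Lemma polyfun_prod m (I : Type) (s : seq I) (P : pred I) (f : I -> 'cV[R]_m -> R) :
  (forall i, polyfun (f i)) -> polyfun (fun x => \prod_(i <- s | P i) f i x).
Proof.
move=> pf; elim: s => [|i s IHs].
  by under eq_fun do rewrite big_nil; exact: polyfun_cst.
under eq_fun do rewrite big_cons.
by case: (P i) => //; exact: polyfunM.
Qed.

Lemma polyfun_comp m k (g : 'cV[R]_m -> 'cV[R]_k) (f : 'cV[R]_k -> R) :
  polymap g -> polyfun f -> polyfun (f \o g).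
Proof.
move=> pg [P fP]; rewrite /comp; under eq_fun do rewrite fP mpoly.mevalE.
apply: polyfun_sum => t; apply: polyfunM; first exact: polyfun_cst.
by apply: polyfun_prod => i; apply: polyfunX.
Qed.

Lemma polymap_cst m k (c : 'cV[R]_k) : polymap (fun _ : 'cV[R]_m => c).
Proof. by move=> i; exact: polyfun_cst. Qed.

Lemma polymap_id m : polymap (fun x : 'cV[R]_m => x).
Proof. by move=> i; exact: polyfun_coord. Qed.

Lemma polymap_usub m k l (g : 'cV[R]_m -> 'cV[R]_(k + l)) :
  polymap g -> polymap (fun x => usubmx (g x)).
Proof. by move=> pg i; under eq_fun do rewrite mxE; exact: pg. Qed.

Lemma polymap_dsub m k l (g : 'cV[R]_m -> 'cV[R]_(k + l)) :
  polymap g -> polymap (fun x => dsubmx (g x)).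
Proof. by move=> pg i; under eq_fun do rewrite mxE; exact: pg. Qed.

Lemma polymap_col m k l (g : 'cV[R]_m -> 'cV[R]_k) (h : 'cV[R]_m -> 'cV[R]_l) :
  polymap g -> polymap h -> polymap (fun x => col_mx (g x) (h x)).
Proof.
move=> pg ph i; case: (split_ordP i) => j ->.
  by under eq_fun do rewrite col_mxEu; exact: pg.
by under eq_fun do rewrite col_mxEd; exact: ph.
Qed.

Lemma polymapB m k (g h : 'cV[R]_m -> 'cV[R]_k) :
  polymap g -> polymap h -> polymap (fun x => g x - h x).
Proof. by move=> pg ph i; under eq_fun do rewrite !mxE; exact: polyfunB. Qed.

End Polynomial_maps.

Ltac polymap_tac := do ![apply: polymap_col|apply: polymap_usub|apply: polymap_dsub|
  exact: polymap_id|apply: polymapB|exact: polymap_cst].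

(** * Boolean operations and polynomial preimages of semialgebraic sets *)

Section Semialgebraic_sets.
Context {R : realType}.
Implicit Types m k : nat.

Lemma semialgebraic_gt0 m (g : 'cV[R]_m -> R) :
  polyfun g -> semialgebraic [set x | 0 < g x].
Proof.
move=> [P gP]; under eq_fun do rewrite gP; exact: semialgebraic_pos.
Qed.

Lemma semialgebraic_lt m (g h : 'cV[R]_m -> R) :
  polyfun g -> polyfun h -> semialgebraic [set x | g x < h x].
Proof.
move=> pg ph; under eq_fun do rewrite -subr_gt0.
exact/semialgebraic_gt0/polyfunB.
Qed.

Lemma semialgebraic_not m (P : 'cV[R]_m -> Prop) :
  semialgebraic [set x | P x] -> semialgebraic [set x | ~ P x].
Proof. exact: semialgebraicC. Qed.

Lemma semialgebraic_and m (P Q : 'cV[R]_m -> Prop) :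
  semialgebraic [set x | P x] -> semialgebraic [set x | Q x] ->
  semialgebraic [set x | P x /\ Q x].
Proof. exact: semialgebraicI. Qed.

Lemma semialgebraic_or m (P Q : 'cV[R]_m -> Prop) :
  semialgebraic [set x | P x] -> semialgebraic [set x | Q x] ->
  semialgebraic [set x | P x \/ Q x].
Proof. exact: semialgebraicU. Qed.

Lemma semialgebraic_imply m (P Q : 'cV[R]_m -> Prop) :
  semialgebraic [set x | P x] -> semialgebraic [set x | Q x] ->
  semialgebraic [set x | P x -> Q x].
Proof.
move=> sP sQ; under eq_fun do rewrite implyE.
by apply: semialgebraic_or => //; exact: semialgebraic_not.
Qed.

Lemma semialgebraic_le m (g h : 'cV[R]_m -> R) :
  polyfun g -> polyfun h -> semialgebraic [set x | g x <= h x].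
Proof.
move=> pg ph; rewrite (_ : mkset _ = [set x | ~ (h x < g x)]).
  exact/semialgebraic_not/semialgebraic_lt.
by apply/seteqP; split=> x /=; [rewrite leNgt => /negP|move/negP; rewrite -leNgt].
Qed.

Lemma semialgebraic_eq m (g h : 'cV[R]_m -> R) :
  polyfun g -> polyfun h -> semialgebraic [set x | g x = h x].
Proof.
move=> pg ph; rewrite (_ : mkset _ = [set x | g x <= h x /\ h x <= g x]).
  by apply: semialgebraic_and; exact: semialgebraic_le.
apply/seteqP; split=> x /=; first by move=> ->.
by move=> gh; apply/eqP; rewrite eq_le; exact/andP.
Qed.

Lemma semialgebraic_prop m (P : Prop) : semialgebraic [set x : 'cV[R]_m | P].
Proof.
have [p|p] := pselect P; last first.
  rewrite (_ : mkset _ = [set x | 1 < (0 : R)]).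
    by apply: semialgebraic_lt; exact: polyfun_cst.
  by apply/seteqP; split=> x //=; rewrite ltr10.
rewrite (_ : mkset _ = [set x | 0 < (1 : R)]).
  by apply: semialgebraic_lt; exact: polyfun_cst.
by apply/seteqP; split=> x //=; rewrite ltr01.
Qed.

Lemma semialgebraic_forall_ord m k (P : 'I_k -> 'cV[R]_m -> Prop) :
  (forall i, semialgebraic [set x | P i x]) ->
  semialgebraic [set x | forall i, P i x].
Proof.
move=> sP.
(* Over a list of indices the conjunction can be peeled off one index at a time. *)
rewrite (_ : mkset _ = [set x | forall i, i \in enum 'I_k -> P i x]); last first.
  by apply/seteqP; split=> x /= Px i // ; apply: Px; rewrite mem_enum.
elim: (enum 'I_k) => [|i s IHs].
  rewrite (_ : mkset _ = [set x | True]); first exact: semialgebraic_prop.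
  by apply/seteqP; split.
rewrite (_ : mkset _ = [set x | P i x /\ forall j, j \in s -> P j x]).
  exact: semialgebraic_and.
apply/seteqP; split=> x /=.
  by move=> Px; split=> [|j js]; apply: Px; rewrite !inE ?eqxx ?js ?orbT.
by move=> [Pi Px] j; rewrite inE => /predU1P[->//|]; exact: Px.
Qed.

Lemma semialgebraic_eqv m k (g h : 'cV[R]_m -> 'cV[R]_k) :
  polymap g -> polymap h -> semialgebraic [set x | g x = h x].
Proof.
move=> pg ph; rewrite (_ : mkset _ = [set x | forall i, g x i 0 = h x i 0]).
  by apply: semialgebraic_forall_ord => i; exact: semialgebraic_eq.
apply/seteqP; split=> x /=; first by move=> ->.
by move=> gh; apply/colP.
Qed.

(** Substituting a polynomial map into a polynomial gives a polynomial, and preimages commute with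
    the Boolean operations. *)
Lemma semialgebraic_preimage m k (g : 'cV[R]_m -> 'cV[R]_k) (P : 'cV[R]_k -> Prop) :
  polymap g -> semialgebraic [set y | P y] -> semialgebraic [set x | P (g x)].
Proof.
move=> pg; rewrite -[[set y | P y]]/(P : set _); elim=> {P} [P|S _ IH|S T _ IHS _ IHT|S T _ IHS _ IHT].
- apply: (semialgebraic_gt0 (g := fun x => mpoly.meval (fun i => g x i 0) P)).
  by apply: (polyfun_comp (f := fun y => mpoly.meval (fun i => y i 0) P) pg); exists P.
- exact: semialgebraic_not.
- exact: semialgebraic_or.
- exact: semialgebraic_and.
Qed.

(** A relation between two columns is coded as a set of stacked columns, the form in which blocks of
    variables are quantified below. *)
Lemma semialgebraic_preimage2 m k l (T : 'cV[R]_k -> 'cV[R]_l -> Prop) g h :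
  polymap g -> polymap h ->
  semialgebraic [set z : 'cV[R]_(k + l) | T (usubmx z) (dsubmx z)] ->
  semialgebraic [set x : 'cV[R]_m | T (g x) (h x)].
Proof.
move=> pg ph sT.
have := semialgebraic_preimage (polymap_col pg ph) sT; congr semialgebraic.
by apply/seteqP; split=> x /=; rewrite col_mxKu col_mxKd.
Qed.

End Semialgebraic_sets.

(** * Tarski-Seidenberg: semialgebraic sets are stable under quantifiers *)

Section Tarski_Seidenberg.
Context {R : realType}.
Implicit Types m k : nat.

Let env m (x : 'cV[R]_m) : seq R := [seq x i 0 | i <- enum 'I_m].

Let size_env m (x : 'cV[R]_m) : size (env x) = m.
Proof. by rewrite size_map size_enum_ord. Qed.

Let nth_env m (x : 'cV[R]_m) (i : 'I_m) : (env x)`_i = x i 0.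
Proof. by rewrite (nth_map i) ?size_enum_ord// nth_ord_enum. Qed.

(** [env] is the valuation of formula variables by coordinates. Stacking one more coordinate is the
    update of variable [m] in the semantics of [Exists m]. *)
Let env_col m (x : 'cV[R]_m) (t : 'cV[R]_1) :
  env (col_mx x t) = set_nth 0 (env x) m (t 0 0).
Proof.
apply: (@eq_from_nth _ 0) => [|i].
  by rewrite size_set_nth !size_env addn1; apply/esym/maxn_idPl.
rewrite size_env => im1; rewrite nth_set_nth/=.
rewrite -[i]/(nat_of_ord (Ordinal im1)) nth_env mxE.
case: splitP => j /= ij.
  by rewrite ij ltn_eqF// nth_env.
by rewrite ij (ord1 j) addn0 eqxx.
Qed.

Let holds m (f : ordered_qelim.ord.formula R) : set 'cV[R]_m :=
  [set x | ordered_qelim.ord.holds (env x) f].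

Let polyfun_term m (t : GRing.term R) : GRing.rterm t ->
  polyfun (fun x : 'cV[R]_m => GRing.eval (env x) t).
Proof.
elim: t => //=.
- move=> i _; have [im|mi] := ltnP i m.
    rewrite -[i]/(nat_of_ord (Ordinal im)).
    by under eq_fun do rewrite nth_env; exact: polyfun_coord.
  (* Variables beyond the dimension read the default value 0 of the list. *)
  under eq_fun do rewrite nth_default ?size_env//.
  exact: polyfun_cst.
- by move=> c _; exact: polyfun_cst.
- by move=> c _; exact: polyfun_cst.
- by move=> s IHs t IHt /andP[/IHs ps /IHt]; exact: polyfunD.
- by move=> s IHs /IHs; exact: polyfunN.
- move=> s IHs k /IHs ps; under eq_fun do rewrite -mulr_natr.
  by apply: polyfunM => //; exact: polyfun_cst.
- by move=> s IHs t IHt /andP[/IHs ps /IHt]; exact: polyfunM.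
- by move=> s IHs k /IHs ps; exact: polyfunX.
Qed.

Let semialgebraic_qf m (f : ordered_qelim.ord.formula R) :
  ordered_qelim.ord.qf_form f -> ordered_qelim.ord.rformula f ->
  semialgebraic (holds (m := m) f).
Proof.
rewrite /holds; elim: f => //=.
- by move=> b _ _; exact: semialgebraic_prop.
- by move=> s t _ /andP[/polyfun_term ps /polyfun_term pt]; exact: semialgebraic_eq.
- by move=> s t _ /andP[/polyfun_term ps /polyfun_term pt]; exact: semialgebraic_lt.
- by move=> s t _ /andP[/polyfun_term ps /polyfun_term pt]; exact: semialgebraic_le.
- move=> f IHf g IHg /andP[qf qg] /andP[rf rg].
  by apply: semialgebraic_and; [exact: IHf|exact: IHg].
- move=> f IHf g IHg /andP[qf qg] /andP[rf rg].
  by apply: semialgebraic_or; [exact: IHf|exact: IHg].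
- move=> f IHf g IHg /andP[qf qg] /andP[rf rg].
  by apply: semialgebraic_imply; [exact: IHf|exact: IHg].
- by move=> f IHf qf rf; apply: semialgebraic_not; exact: IHf.
Qed.

Let term_of_mpoly m (P : mpoly.mpoly m R) : exists t : GRing.term R,
  forall x : 'cV[R]_m, GRing.eval (env x) t = mpoly.meval (fun i => x i 0) P.
Proof.
have prodT (mm : 'I_m -> nat) (s : seq 'I_m) : exists t : GRing.term R,
    forall x : 'cV[R]_m, GRing.eval (env x) t = \prod_(i <- s) x i 0 ^+ mm i.
  elim: s => [|i s [t tE]].
    by exists (GRing.Const 1) => x; rewrite big_nil.
  exists (GRing.Mul (GRing.Exp (GRing.Var R i) (mm i)) t) => x /=.
  by rewrite big_cons tE nth_env.
(* The support is generalized to an arbitrary list of monomials, for the induction. *)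
suff sumT (s : seq (mpoly.multinom m)) : exists t : GRing.term R,
    forall x : 'cV[R]_m, GRing.eval (env x) t =
      \sum_(mm <- s) mpoly.mcoeff mm P * \prod_i x i 0 ^+ mm i.
  have [t tE] := sumT (mpoly.msupp P).
  by exists t => x; rewrite tE mpoly.mevalE.
elim: s => [|mm s [t tE]].
  by exists (GRing.Const 0) => x; rewrite big_nil.
have [u uE] := prodT mm (index_enum _).
exists (GRing.Add (GRing.Mul (GRing.Const (mpoly.mcoeff mm P)) u) t) => x /=.
by rewrite big_cons tE uE.
Qed.

Let formula_of_semialgebraic m (S : set 'cV[R]_m) :
  semialgebraic S -> exists f, S = holds f.
Proof.
elim=> {S} [P|S _ [f ->]|S T _ [f ->] _ [g ->]|S T _ [f ->] _ [g ->]].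
- have [t tE] := term_of_mpoly P.
  exists (ordered_qelim.ord.Lt (GRing.Const 0) t).
  by apply/seteqP; split=> x; rewrite /holds /= tE.
- by exists (ordered_qelim.ord.Not f).
- by exists (ordered_qelim.ord.Or f g).
- by exists (ordered_qelim.ord.And f g).
Qed.


(** The set is written as a first-order formula, variable [m] is quantified, and quantifier
    elimination over the real closed field [R] returns a quantifier-free formula, which defines a
    semialgebraic set. *)
Lemma semialgebraic_ex1 m (T : 'cV[R]_m -> 'cV[R]_1 -> Prop) :
  semialgebraic [set z : 'cV[R]_(m + 1) | T (usubmx z) (dsubmx z)] ->
  semialgebraic [set x | exists u, T x u].
Proof.
move=> /formula_of_semialgebraic[f Sf].
(* Only the meaning of [f] is known, not its syntax, so possible inverses are removed before the
   elimination. *)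
pose h := ordered_qelim.ord.to_rform (ordered_qelim.ord.Exists m f).
have rh : ordered_qelim.ord.rformula h by exact: ordered_qelim.ord.to_rform_rformula.
have /andP[qg rg] :=
  ordered_qelim.ord.quantifier_elim_wf (@qe_rcf.wf_QE_wproj R) rh.
have := semialgebraic_qf m qg rg; congr semialgebraic.
apply/seteqP; split=> x; rewrite /holds /=.
  move=> /(ordered_qelim.ord.qf_evalP _ qg).
  move=> /(ordered_qelim.ord.quantifier_elim_rformP
             (@qe_rcf.wf_QE_wproj R) (@qe_rcf.valid_QE_wproj R) _ rh).
  move=> /ordered_qelim.ord.to_rformP/= [t]; rewrite -(_ : (t%:M : 'cV_1) 0 0 = t).
    rewrite -env_col => ft; exists t%:M.
    suff : [set z : 'cV[R]_(m + 1) | T (usubmx z) (dsubmx z)] (col_mx x t%:M).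
      by rewrite /= col_mxKu col_mxKd.
    by rewrite Sf.
  by rewrite mxE.
move=> [u xu]; apply/(ordered_qelim.ord.qf_evalP _ qg).
apply/(ordered_qelim.ord.quantifier_elim_rformP
             (@qe_rcf.wf_QE_wproj R) (@qe_rcf.valid_QE_wproj R) _ rh).
apply/ordered_qelim.ord.to_rformP => /=; exists (u 0 0).
rewrite -env_col -[ordered_qelim.ord.holds _ _]/(holds f (col_mx x u)) -Sf /=.
by rewrite col_mxKu col_mxKd.
Qed.

(** Induction on the size of the block: its first coordinate joins the parameters while the others
    are eliminated, hence [m] and [T] vary. *)
Lemma semialgebraic_ex m k (T : 'cV[R]_m -> 'cV[R]_k -> Prop) :
  semialgebraic [set z : 'cV[R]_(m + k) | T (usubmx z) (dsubmx z)] ->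
  semialgebraic [set x | exists u, T x u].
Proof.
elim: k m T => [|k IHk] m T sT.
  rewrite (_ : mkset _ = [set x | T x 0]).
    by apply: semialgebraic_preimage2 sT; [exact: polymap_id|exact: polymap_cst].
  apply/seteqP; split=> x /=; last by exists 0.
  by move=> [u]; rewrite (flatmx0 u).
rewrite (_ : mkset _ =
  [set x | exists t : 'cV_1, exists u : 'cV_k, T x (col_mx t u)]).
  apply: semialgebraic_ex1; apply: (IHk (m + 1)%N (fun z u => T (usubmx z) (col_mx (dsubmx z) u))).
  apply: (semialgebraic_preimage2 (h := fun w : 'cV[R]_((m + 1) + k) =>
    col_mx (dsubmx (usubmx w)) (dsubmx w)) _ _ sT);
  by do ![apply: polymap_col|apply: polymap_usub|apply: polymap_dsub|exact: polymap_id].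
apply/seteqP; split=> x /= [u].
  by rewrite -[u](@vsubmxK _ 1 k); exists (usubmx (u : 'cV_(1 + k))), (dsubmx (u : 'cV_(1 + k))).
by move=> [w Tuw]; exists (col_mx u w).
Qed.

Lemma semialgebraic_all m k (T : 'cV[R]_m -> 'cV[R]_k -> Prop) :
  semialgebraic [set z : 'cV[R]_(m + k) | T (usubmx z) (dsubmx z)] ->
  semialgebraic [set x | forall u, T x u].
Proof.
move=> /semialgebraic_not sT.
have /semialgebraic_not := semialgebraic_ex (T := fun x u => ~ T x u) sT.
by under eq_fun do rewrite -forallNE; under eq_fun do under eq_forall do rewrite notK.
Qed.

End Tarski_Seidenberg.

(** * Graphs of semialgebraic functions in formulas *)

Section Semialgebraic_functions.
Context {R : realType}.
Implicit Types m n k : nat.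

(** This puts the graph in the two-block form used for quantification. *)
Lemma semialgebraic_funP m k (D : set 'cV[R]_m) (f : 'cV[R]_m -> 'cV[R]_k) :
  semialgebraic_fun D f <->
  semialgebraic [set z : 'cV[R]_(m + k) | D (usubmx z) /\ f (usubmx z) = dsubmx z].
Proof.
rewrite /semialgebraic_fun (_ : [set col_mx x (f x) | x in D] =
  [set z : 'cV[R]_(m + k) | D (usubmx z) /\ f (usubmx z) = dsubmx z])//.
apply/seteqP; split=> z /=; first by move=> [x Dx <-]; rewrite col_mxKu col_mxKd.
by move=> [Dz fz]; exists (usubmx z) => //; rewrite fz vsubmxK.
Qed.

Lemma semialgebraic_graph m k l (D : set 'cV[R]_m) (f : 'cV[R]_m -> 'cV[R]_k)
    (g : 'cV[R]_l -> 'cV[R]_m) (h : 'cV[R]_l -> 'cV[R]_k) :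
  semialgebraic_fun D f -> polymap g -> polymap h ->
  semialgebraic [set x | D (g x) /\ f (g x) = h x].
Proof.
move=> /semialgebraic_funP sf pg ph.
exact: (semialgebraic_preimage2 (T := fun y u => D y /\ f y = u) pg ph sf).
Qed.

Lemma polymap_mulmx m k l (M : 'cV[R]_m -> 'M[R]_(k, l)) (w : 'cV[R]_m -> 'cV[R]_l) :
  (forall i j, polyfun (fun x => M x i j)) -> polymap w ->
  polymap (fun x => M x *m w x).
Proof.
move=> pM pw i; under eq_fun do rewrite mxE.
by apply: polyfun_sum => j; exact: polyfunM.
Qed.

End Semialgebraic_functions.

(** * Orthogonal projections and normal equations *)

Section Orthogonal_projection.
Context {R : realType}.
Implicit Types r s : nat.

(** Norms are compared through [dotv u u], which is polynomial, so that no square root enters the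
    formulas. *)
Definition dotv s (u w : 'cV[R]_s) : R := \sum_i u i 0 * w i 0.

Lemma dotvE s (u w : 'cV[R]_s) : dotv u w = (u^T *m w) 0 0.
Proof. by rewrite mxE; apply: eq_bigr => i _; rewrite mxE. Qed.

Lemma dotvv_ge0 s (u : 'cV[R]_s) : 0 <= dotv u u.
Proof. by apply: sumr_ge0 => i _; rewrite -expr2 sqr_ge0. Qed.

Lemma dotvv_eq0 s (u : 'cV[R]_s) : dotv u u = 0 -> u = 0.
Proof.
move=> /eqP; rewrite psumr_eq0 => [/allP u0|i _]; last by rewrite -expr2 sqr_ge0.
apply/colP => i; rewrite mxE.
by have /= := u0 i (mem_index_enum _); rewrite mulf_eq0 orbb => /eqP.
Qed.

Lemma enorm_le s (u w : 'cV[R]_s) : (enorm u <= enorm w) = (dotv u u <= dotv w w).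
Proof.
rewrite /enorm; under eq_bigr do rewrite expr2.
under [X in _ <= Num.sqrt X]eq_bigr do rewrite expr2.
by rewrite ler_sqrt// dotvv_ge0.
Qed.

Lemma enorm_lt s (u : 'cV[R]_s) c : 0 < c -> (enorm u < c) = (dotv u u < c ^+ 2).
Proof.
by move=> c0; rewrite -[in LHS](gtr0_norm c0) -sqrtr_sqr /enorm ltr_sqrt ?exprn_gt0//.
Qed.

Lemma sqr_coord_le s (u : 'cV[R]_s) i : u i 0 ^+ 2 <= dotv u u.
Proof.
rewrite /dotv (bigD1 i)//= expr2 lerDl; apply: sumr_ge0 => j _.
by rewrite -expr2 sqr_ge0.
Qed.

Lemma coord_le_enorm s (u : 'cV[R]_s) i : `|u i 0| <= enorm u.
Proof.
rewrite -sqrtr_sqr /enorm ler_wsqrtr//.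
by under [leRHS]eq_bigr do rewrite expr2; exact: sqr_coord_le.
Qed.

Lemma dotvDD s (u w : 'cV[R]_s) : dotv u w = 0 ->
  dotv (u + w) (u + w) = dotv u u + dotv w w.
Proof.
move=> uw; have wu : dotv w u = 0.
  by rewrite -uw /dotv; apply: eq_bigr => i _; rewrite mulrC.
rewrite -[RHS]addr0 -(mulr0 2) -uw /dotv mulr_sumr -!big_split/=.
by apply: eq_bigr => i _; rewrite mxE; ring.
Qed.

(** The matrix M M^T has the same row space as M^T, by equality of ranks, so the normal equations
    are always solvable. *)
Lemma gram_solvable r s (M : 'M[R]_(r, s)) (u : 'cV[R]_s) :
  exists z : 'cV[R]_r, M *m (M^T *m z) = M *m u.
Proof.
have MMT : (M *m M^T == M^T)%MS.
  rewrite -(geq_leqif (mxrank_leqif_eq (submxMl _ _))) mxrank_tr.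
  rewrite -(mxrank_mul_ker M M^T) -[leqRHS]addn0 leq_add2l leqn0 mxrank_eq0.
  apply/eqP/row_matrixP => i; rewrite row0; set x := row i _.
  have : (x <= M :&: kermx M^T)%MS by exact: row_sub.
  rewrite sub_capmx => /andP[/submxP[c xE] /sub_kermxP xM].
  (* With x = c M and x M^T = 0, one gets x x^T = c M x^T = 0, hence x = 0. *)
  apply: trmx_inj; rewrite trmx0; apply: dotvv_eq0.
  by rewrite dotvE trmxK {1}xE -mulmxA -[M *m _]trmxK trmx_mul trmxK xM trmx0 mulmx0 mxE.
have /submxP[c cE] : (u^T *m M^T <= M *m M^T)%MS.
  by rewrite (eqmxP MMT) submxMl.
exists c^T; apply: trmx_inj; rewrite mulmxA !trmx_mul trmxK trmxK.
by rewrite cE mulmxA.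
Qed.

(** By Pythagoras, the squared distance from [w] to [u'] exceeds that to [u] by the squared norm of
    [u - u']; so [u] is a minimizer, and the only one. *)
Lemma closest_pointE s (V : set 'cV[R]_s) (w u : 'cV[R]_s) :
  V u -> (forall u', V u' -> dotv (w - u) (u - u') = 0) -> closest_point V w = u.
Proof.
move=> Vu wu.
have pyth u' : V u' -> dotv (w - u') (w - u') =
    dotv (w - u) (w - u) + dotv (u - u') (u - u').
  by move=> /wu /dotvDD; rewrite addrA subrK.
rewrite /closest_point; apply: xget_unique => [|y [Vy /(_ _ Vu)]].
  by split=> // u' Vu'; rewrite enorm_le (pyth _ Vu') lerDl dotvv_ge0.
rewrite enorm_le (pyth _ Vy) gerDl => uy; apply/eqP; rewrite -subr_eq0 -oppr_eq0 opprB.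
by apply/eqP/dotvv_eq0/eqP; rewrite eq_le uy dotvv_ge0.
Qed.

End Orthogonal_projection.

(** * Projection onto the fibers of the system *)

Section Fiber_projection.
Context {R : realType} {n r s : nat}.
Variables (A : 'cV[R]_n -> 'M[R]_(r, s)) (gamma : 'cV[R]_n -> 'cV[R]_r).

Lemma ker_orth_dotv (M : 'M[R]_(r, s)) (u w : 'cV[R]_s) :
  ker_orth M w -> M *m u = 0 -> dotv w u = 0.
Proof. by move=> Mw Mu; rewrite -[RHS](Mw u Mu); apply: eq_bigr => i _; rewrite mulrC. Qed.

(** Two points of a fiber differ by a kernel vector, so a residual orthogonal to the kernel
    identifies the closest point. *)
Lemma fiber_projE v y w :
  A y *m w = gamma y -> ker_orth (A y) (v - w) -> fiber_proj A gamma v y = w.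
Proof.
move=> Aw ow; apply: closest_pointE => // u Au; apply: (ker_orth_dotv ow).
by rewrite mulmxBr Aw Au subrr.
Qed.

(** The projection is [v] moved by a vector of the range of the transpose, which is orthogonal to
    the kernel. The normal equations for [u - v] make the moved point land in the fiber. *)
Lemma fiber_projP v y u : A y *m u = gamma y ->
  A y *m fiber_proj A gamma v y = gamma y /\ ker_orth (A y) (v - fiber_proj A gamma v y).
Proof.
move=> Au; have [z zE] := gram_solvable (A y) (u - v).
suff [Aw ow] : A y *m (v + (A y)^T *m z) = gamma y /\
    ker_orth (A y) (v - (v + (A y)^T *m z)) by rewrite (fiber_projE Aw ow).
split; first by rewrite mulmxDr zE -mulmxDr addrC subrK.
move=> x Ax; rewrite -[LHS]/(dotv x _) opprD addNKr dotvE mulmxN mulmxA.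
by rewrite -trmx_mul Ax trmx0 mul0mx oppr0 mxE.
Qed.

Lemma fiber_proj_le v y u : A y *m u = gamma y ->
  enorm (v - fiber_proj A gamma v y) <= enorm (v - u).
Proof.
move=> Au; have [Aw ow] := fiber_projP v Au.
have /dotvDD : dotv (v - fiber_proj A gamma v y) (fiber_proj A gamma v y - u) = 0.
  by apply: (ker_orth_dotv ow); rewrite mulmxBr Aw Au subrr.
by rewrite addrA subrK enorm_le => ->; rewrite lerDl dotvv_ge0.
Qed.

(** The fiber point [w] nearest to 0 is orthogonal to the kernel, and [u - w] lies in the kernel;
    hence [w] is the projection of [u]. This identifies p with gamma_0, whatever solution is
    chosen. *)
Lemma closest_point_ker_orth y u : A y *m u = gamma y ->
  closest_point (ker_orth (A y)) u = fiber_proj A gamma 0 y.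
Proof.
move=> Au; have [Aw] := fiber_projP 0 Au; rewrite sub0r.
set w := fiber_proj _ _ _ _ => ow.
have ow' : ker_orth (A y) w.
  move=> x Ax; rewrite -[RHS]oppr0 -[in RHS](ow x Ax) -sumrN.
  by apply: eq_bigr => i _; rewrite mxE mulrN opprK.
apply: closest_pointE => // u' ou'.
have Auw : A y *m (u - w) = 0 by rewrite mulmxBr Au Aw subrr.
transitivity (dotv (u - w) w - dotv (u - w) u').
  by rewrite /dotv -sumrB; apply: eq_bigr => i _; rewrite !mxE mulrBr.
by rewrite /dotv ow' // ou' // subrr.
Qed.

(** On nonempty fibers the projection is characterized by a first-order condition: it solves the
    system and its residual is orthogonal to the kernel. *)
Lemma semialgebraic_fiber_proj (Q : set 'cV[R]_n) (phi : 'cV[R]_n -> 'cV[R]_s) v :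
  semialgebraic_mxfun Q A -> semialgebraic_fun Q gamma -> solution Q A gamma phi ->
  semialgebraic_fun Q (fiber_proj A gamma v).
Proof.
move=> sA sg sol; apply/semialgebraic_funP.
(* [M] rebuilds a matrix from its flattened column; its entries are coordinates of [a]. *)
pose M (a : 'cV[R]_(r * s)) : 'M[R]_(r, s) := vec_mx a^T.
have pM k (g : 'cV[R]_k -> 'cV[R]_(r * s)) i j : polymap g -> polyfun (fun x => M (g x) i j).
  by move=> pg; rewrite /M; under eq_fun do rewrite !mxE; exact: pg.
(* [a] and [b] name the values of [A] and [gamma], which enter a formula only through their
   graphs. *)
rewrite (_ : mkset _ = [set z : 'cV[R]_(n + s) | exists a : 'cV[R]_(r * s),
  exists b : 'cV[R]_r, ((Q (usubmx z) /\ (mxvec (A (usubmx z)))^T = a) /\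
     (Q (usubmx z) /\ gamma (usubmx z) = b)) /\
    (M a *m dsubmx z = b /\ forall u : 'cV[R]_s, M a *m u = 0 -> dotv u (v - dsubmx z) = 0)]).
  apply: semialgebraic_ex; apply: semialgebraic_ex; apply: semialgebraic_and.
    by apply: semialgebraic_and; [apply: (semialgebraic_graph sA)|
      apply: (semialgebraic_graph sg)]; polymap_tac.
  apply: semialgebraic_and.
    apply: semialgebraic_eqv; last by polymap_tac.
    by apply: polymap_mulmx => [i j|]; [apply: pM|]; polymap_tac.
  apply: semialgebraic_all; apply: semialgebraic_imply.
    apply: semialgebraic_eqv; last by polymap_tac.
    by apply: polymap_mulmx => [i j|]; [apply: pM|]; polymap_tac.
  apply: semialgebraic_eq; last exact: polyfun_cst.
  have pv : polymap (fun z : 'cV[R]_(n + s + r * s + r + s) =>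
    v - dsubmx (usubmx (usubmx (usubmx z)))) by polymap_tac.
  have pd : polymap (fun z : 'cV[R]_(n + s + r * s + r + s) => dsubmx z) by polymap_tac.
  by apply: polyfun_sum => i; exact: polyfunM.
have MA y : M (mxvec (A y))^T = A y by rewrite /M trmxK mxvecK.
apply/seteqP; split=> z /=.
  move=> [Qz <-]; have [Aw ow] := fiber_projP v (sol _ Qz).
  by exists (mxvec (A (usubmx z)))^T, (gamma (usubmx z)); rewrite MA.
move=> [a [b [[[Qz <-] [_ <-]]]]]; rewrite MA => -[Aw ow]; split=> //.
exact: fiber_projE.
Qed.

End Fiber_projection.

(** * Semialgebraic subsets of the line *)

Section Dimension_one.
Context {R : realType}.

Lemma seq_isolated (F : seq R) t :
  exists2 e : R, 0 < e & forall c, c \in F -> c != t -> e <= `|c - t|.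
Proof.
elim: F => [|a F [e e0 eF]]; first by exists 1.
have [->|at0] := eqVneq a t.
  by exists e => // c; rewrite inE => /predU1P[->|/eF//]; rewrite eqxx.
exists (Num.min e `|a - t|); first by rewrite lt_min e0 normr_gt0 subr_eq0.
move=> c; rewrite inE => /predU1P[-> _|cF ct]; first by rewrite ge_min lexx orbT.
by rewrite ge_min eF.
Qed.

Lemma polyfun_horner (f : 'cV[R]_1 -> R) : polyfun f ->
  exists p : {poly R}, forall t : R, f t%:M = p.[t].
Proof.
move=> [P fP]; exists (\sum_(m <- mpoly.msupp P)
  (mpoly.mcoeff m P) *: \prod_(i < 1) 'X^(m i)) => t.
rewrite fP mpoly.mevalE horner_sum; apply: eq_bigr => m _.
rewrite hornerZ horner_prod; congr (_ * _); apply: eq_bigr => i _.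
by rewrite hornerXn mxE (ord1 i).
Qed.

(** [F] collects the roots of the polynomials that define [S]. Between two points with no such root
    in between, no polynomial changes sign, so membership does not change. *)
Lemma semialgebraic_locally_constant (S : set 'cV[R]_1) : semialgebraic S ->
  exists F : seq R, forall a b : R, a <= b -> (forall c, c \in F -> ~~ (a <= c <= b)) ->
    S a%:M <-> S b%:M.
Proof.
elim=> {S} [P|S _ [F FS]|S T _ [F FS] _ [G GT]|S T _ [F FS] _ [G GT]].
- have [|p pE] := @polyfun_horner (fun x => mpoly.meval (fun i => x i 0) P); first by exists P.
  exists (polyrcf.rootsR p) => a b ab Fab /=; rewrite !pE.
  (* No list holds all roots of the zero polynomial, but its sign is constant. *)
  have [->|p0] := eqVneq p 0; first by rewrite !horner0.
  have nr : {in `[a, b]%R, forall x, ~~ root p x}.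
    move=> x; rewrite in_itv/= => xab; apply/negP => px.
    have /Fab : x \in polyrcf.rootsR p by rewrite -(polyrcf.roots_on_rootsR p0) px.
    by rewrite xab.
  have [aab bab] : a \in `[a, b]%R /\ b \in `[a, b]%R by rewrite !in_itv/= !lexx ab.
  have := polyrcf.noroot_noivt nr aab bab => pab; split=> h.
    by move: pab; rewrite pmulr_rgt0.
  by move: pab; rewrite pmulr_lgt0.
- by exists F => a b ab Fab; rewrite /setC/= (propext (FS a b ab Fab)).
- exists (F ++ G) => a b ab FG; rewrite /setU/=.
  by rewrite (propext (FS a b ab _)) ?(propext (GT a b ab _))// => c cF;
    apply: FG; rewrite mem_cat cF ?orbT.
- exists (F ++ G) => a b ab FG; rewrite /setI/=.
  by rewrite (propext (FS a b ab _)) ?(propext (GT a b ab _))// => c cF;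
    apply: FG; rewrite mem_cat cF ?orbT.
Qed.

(** A countable set is Lebesgue null, whereas the interval has measure [b - a]. *)
Lemma uncountable_itvoo (a b : R) : a < b -> ~ countable `]a, b[.
Proof.
move=> ab /countable_lebesgue_measure0 /eqP.
by rewrite lebesgue_measure_itv/= lte_fin ab -EFinB eqe subr_eq0 gt_eqF.
Qed.

(** A point of [S] outside [F] keeps a positive distance [e] from [F], so [S] contains an open
    interval around it and is uncountable. *)
Lemma semialgebraic_countable_finite (S : set 'cV[R]_1) : semialgebraic S ->
  countable [set t : R | S t%:M] -> exists F : seq R, forall t, S t%:M -> t \in F.
Proof.
move=> /semialgebraic_locally_constant[F FS] Sc; exists F => t St.
apply/negPn/negP => tF; have [e e0 eF] := seq_isolated F t.
have {}eF c : c \in F -> e <= `|c - t|.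
  by move=> cF; apply: eF => //; apply: contraNneq tF => <-.
apply: (@uncountable_itvoo (t - e) (t + e)); first lra.
apply: sub_countable Sc; apply: subset_card_le => u /=; rewrite in_itv/= => /andP[tu ut].
have [ut'|/ltW tu'] := leP u t.
  apply/(FS _ _ ut') => // c /eF; apply: contraTN => /andP[uc ct].
  by rewrite -ltNge ltr_norml; apply/andP; split; lra.
apply/(FS _ _ tu') => // c /eF; apply: contraTN => /andP[uc ct].
by rewrite -ltNge ltr_norml; apply/andP; split; lra.
Qed.

End Dimension_one.

(** * Neighborhoods, limits and isolated points in coordinates *)

Section Column_topology.
Context {R : realType}.
Implicit Types n k : nat.

Lemma nbhs_colP n (y : 'cV[R]_n) (P : set 'cV[R]_n) : nbhs y P <->
  exists2 d : R, 0 < d & forall y' : 'cV[R]_n, (forall i, `|y i 0 - y' i 0| < d) -> P y'.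
Proof.
split=> [/nbhs_ballP[d /= d0 yP]|[d d0 yP]].
  exists d => // y' yy'; apply: yP; split=> // i j; rewrite (ord1 j).
  exact: yy'.
apply/nbhs_ballP; exists d => //= y' [_ yy']; apply: yP => i; exact: (yy' i 0).
Qed.

(** The epsilon-delta form in coordinates can be written as a first-order formula. *)
Lemma cvg_within_colP n k (B : set 'cV[R]_n) (f : 'cV[R]_n -> 'cV[R]_k)
    (y : 'cV[R]_n) (l : 'cV[R]_k) :
  f @ within B (nbhs y) --> l <->
  forall e : R, 0 < e -> exists2 d : R, 0 < d & forall y' : 'cV[R]_n, B y' ->
    (forall i, `|y i 0 - y' i 0| < d) -> forall j, `|l j 0 - f y' j 0| < e.
Proof.
split=> [/cvg_ballP fl e /fl|fl].
  rewrite near_withinE => /nbhs_colP[d d0 yd]; exists d => // y' By' /yd /(_ By')[_ lf] j.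
  exact: (lf j 0).
apply/cvg_ballP => e e0; rewrite near_withinE; apply/nbhs_colP.
have [d d0 yd] := fl e e0; exists d => // y' yy' By'; split=> // i j.
by rewrite (ord1 j); exact: yd.
Qed.

(** This transfers continuity from a ball of [Q] to [Q] itself at the points of the ball. *)
Lemma cvg_within_near n k (B C : set 'cV[R]_n) (f : 'cV[R]_n -> 'cV[R]_k)
    (y : 'cV[R]_n) (l : 'cV[R]_k) : (\forall z \near y, C z -> B z) ->
  f @ within B (nbhs y) --> l -> f @ within C (nbhs y) --> l.
Proof.
move=> /nbhs_colP[d d0 CB] /cvg_within_colP fl; apply/cvg_within_colP => e /fl[d' d'0 d'P].
exists (Num.min d d'); first by rewrite lt_min d0.
by move=> z Cz yz; apply: d'P => [|i]; [apply: CB => // i|];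
  have := yz i; rewrite lt_min => /andP[].
Qed.

Lemma countable_isolated_col n (D : set 'cV[R]_n) : D `<=` isolated D -> countable D.
Proof.
move=> Diso.
(* A rational point within 1/(N+1) of [x] determines [x] once 2/(N+1) isolates it. *)
have code (x : 'cV[R]_n) : exists q : 'cV[rat]_n * nat, D x ->
   (forall i, `|x i 0 - ratr (q.1 i 0)| < q.2.+1%:R^-1) /\
   forall y : 'cV[R]_n, D y -> (forall i, `|x i 0 - y i 0| < q.2.+1%:R^-1 + q.2.+1%:R^-1) -> y = x.
  have [Dx|nDx] := pselect (D x); last by exists (0, 0%N) => /nDx.
  have [_ [V /nbhs_colP[d d0 dV] VD]] := Diso _ Dx.
  have [|N] := @ltr_add_invr R 0 (d / 2); first by rewrite divr_gt0.
  rewrite add0r => Nd.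
  have rq i : exists q : rat, `|x i 0 - ratr q| < N.+1%:R^-1.
    have N0 : 0 < N.+1%:R^-1 :> R by rewrite invr_gt0.
    have [|q] := @rat_in_itvoo R (x i 0 - N.+1%:R^-1) (x i 0 + N.+1%:R^-1).
      by rewrite ltrBlDr -addrA ltrDl addr_gt0.
    by rewrite inE/= => /andP[]; rewrite !bnd_simp => xq qx; exists q; rewrite ltr_distlC xq.
  exists (\col_i sval (cid (rq i)), N) => _ /=; split=> [i|y Dy xy].
    by rewrite mxE; case: cid.
  suff : (V `&` D) y by rewrite VD.
  by split=> //; apply: dV => i; apply: lt_trans (xy i) _; rewrite [ltRHS]splitr ltrD.
have [c cP] := choice code.
apply/pcard_injP; exists (pickle \o c) => x y /set_mem Dx /set_mem Dy /=.
move=> /(pcan_inj pickleK) cxy; have [xc _] := cP x Dx; have [yc ycP] := cP y Dy.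
apply: ycP => // i; rewrite -(subrK (ratr ((c y).1 i 0)) (y i 0)) -addrA.
apply: le_lt_trans (ler_normD _ _) _; rewrite ltrD//.
by rewrite -cxy distrC.
Qed.

End Column_topology.

(** * Discontinuity sets of semialgebraic functions *)

Section Discontinuities.
Context {R : realType} {n : nat}.

Lemma semialgebraic_norm_lt m (g h : 'cV[R]_m -> R) :
  polyfun g -> polyfun h -> semialgebraic [set x | `|g x| < h x].
Proof.
move=> pg ph; rewrite (_ : mkset _ = [set x | - h x < g x /\ g x < h x]).
  by apply: semialgebraic_and; apply: semialgebraic_lt => //; exact: polyfunN.
by apply/seteqP; split=> x /=; rewrite ltr_norml => /andP.
Qed.

(** Failure of the epsilon-delta condition is first-order once values of [f] are replaced by
    variables [l], [l'] bound to the graph. Epsilon and delta are columns of size 1 because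
    quantifiers range over columns. *)
Lemma semialgebraic_discontinuities k (B : set 'cV[R]_n) (f : 'cV[R]_n -> 'cV[R]_k) :
  semialgebraic_fun B f -> semialgebraic (discontinuities B f).
Proof.
move=> sf; rewrite (_ : discontinuities B f = [set y | exists l : 'cV[R]_k,
  (B y /\ f y = l) /\ ~ (forall e : 'cV[R]_1, 0 < e 0 0 -> exists d : 'cV[R]_1,
   0 < d 0 0 /\ (forall y' : 'cV[R]_n, forall l' : 'cV[R]_k, (B y' /\ f y' = l') ->
     (forall i, `|y i 0 - y' i 0| < d 0 0) -> forall j, `|l j 0 - l' j 0| < e 0 0))]).
  have pu m a b (g : 'cV[R]_m -> 'cV[R]_(a + b)) i : polymap g ->
    polyfun (fun x => usubmx (g x) i 0) by move=> pg; exact: (polymap_usub pg i).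
  have pd m a b (g : 'cV[R]_m -> 'cV[R]_(a + b)) i : polymap g ->
    polyfun (fun x => dsubmx (g x) i 0) by move=> pg; exact: (polymap_dsub pg i).
  apply: semialgebraic_ex; apply: semialgebraic_and.
    by apply: (semialgebraic_graph sf); polymap_tac.
  apply: semialgebraic_not; apply: semialgebraic_all; apply: semialgebraic_imply.
    by apply: semialgebraic_lt; [exact: polyfun_cst|apply: pd; polymap_tac].
  apply: semialgebraic_ex; apply: semialgebraic_and.
    by apply: semialgebraic_lt; [exact: polyfun_cst|apply: pd; polymap_tac].
  apply: semialgebraic_all; apply: semialgebraic_all; apply: semialgebraic_imply.
    by apply: (semialgebraic_graph sf); polymap_tac.
  apply: semialgebraic_imply.
    apply: semialgebraic_forall_ord => i; apply: semialgebraic_norm_lt.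
      by apply: polyfunB; [apply: pu|apply: pd]; polymap_tac.
    by apply: pd; polymap_tac.
  apply: semialgebraic_forall_ord => i; apply: semialgebraic_norm_lt.
    by apply: polyfunB; apply: pd; polymap_tac.
  by apply: pd; polymap_tac.
apply/seteqP; split=> y /=.
  move=> [By nf]; exists (f y); split=> // fy; apply: nf; apply/cvg_within_colP => e e0.
  have [|d [d0 dP]] := fy e%:M; first by rewrite mxE.
  exists (d 0 0) => // y' By' yy' j; have := dP y' _ (conj By' erefl) yy' j.
  by rewrite mxE.
move=> [l [[By <-] nf]]; split=> // /cvg_within_colP fy; apply: nf => e e0.
have [d d0 dP] := fy _ e0; exists d%:M; rewrite mxE; split=> // y' l' [By' <-].
exact: dP.
Qed.

(** The coordinate image of [D] is semialgebraic as a projection and countable because [D] is. *)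
Lemma finite_coord_isolated (D : set 'cV[R]_n) (i : 'I_n) :
  semialgebraic D -> D `<=` isolated D ->
  exists F : seq R, forall y : 'cV[R]_n, D y -> y i 0 \in F.
Proof.
move=> sD /countable_isolated_col cD.
have [||F FP] := @semialgebraic_countable_finite R
  [set t | exists y : 'cV[R]_n, D y /\ y i 0 = t 0 0].
- apply: semialgebraic_ex; apply: semialgebraic_and.
    by apply: (semialgebraic_preimage _ sD); polymap_tac.
  by apply: semialgebraic_eq; [apply: polymap_dsub|apply: polymap_usub]; polymap_tac.
- rewrite (_ : mkset _ = (fun y : 'cV[R]_n => y i 0) @` D).
    exact: sub_countable (card_image_le _ _) cD.
  apply/seteqP; split=> t /=.
    by move=> [y [Dy]]; rewrite mxE mulr1n => <-; exists y.
  by move=> [y Dy <-]; exists y; rewrite mxE.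
- by exists F => y Dy; apply: FP; exists y; rewrite mxE.
Qed.

(** [D] lies in a finite grid, so a point of [D] close enough to [x] shares every coordinate with
    it. *)
Lemma semialgebraic_isolated_near (D : set 'cV[R]_n) (x : 'cV[R]_n) :
  semialgebraic D -> D `<=` isolated D -> \forall y \near x, D y -> y = x.
Proof.
move=> sD isoD.
have : \forall y \near x, forall i, D y -> y i 0 = x i 0.
  apply: (@filter_forall 'cV[R]_n 'I_n (fun i y => D y -> y i 0 = x i 0)
    (nbhs x) (nbhs_filter x)) => i; have [F FP] := finite_coord_isolated i sD isoD.
  have [e e0 eF] := seq_isolated F (x i 0).
  apply/nbhs_colP; exists e => // y xy /FP yF; apply/eqP/negPn/negP => yx.
  by have := eF _ yF yx; rewrite distrC leNgt xy.
by apply: filterS => y yx Dy; apply/colP => i; exact: yx.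
Qed.

End Discontinuities.

(** * Gluing solutions with semialgebraic cutoffs *)

Section Gluing.
Context {R : realType} {n s : nat}.
Implicit Types (Q : set 'cV[R]_n) (f g : 'cV[R]_n -> 'cV[R]_s).

Lemma polyfun_continuous (f : 'cV[R]_n -> R) : polyfun f -> continuous f.
Proof.
move=> [P fP]; rewrite (_ : f = fun x => \sum_(m <- mpoly.msupp P)
    mpoly.mcoeff m P * \prod_i x i 0 ^+ m i); last first.
  by apply/funext => y; rewrite fP mpoly.mevalE.
have cD (g h : 'cV[R]_n -> R) : continuous g -> continuous h ->
    continuous (fun x => g x + h x).
  by move=> cg ch x; exact: (@cvgD _ _ _ (nbhs x) _ g h _ _ (cg x) (ch x)).
have cM (g h : 'cV[R]_n -> R) : continuous g -> continuous h ->
    continuous (fun x => g x * h x).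
  by move=> cg ch x; exact: (@cvgM _ _ (nbhs x) _ g h _ _ (cg x) (ch x)).
elim: (mpoly.msupp P) => [|m ms IHms].
  by under eq_fun do rewrite big_nil; exact: cst_continuous.
under eq_fun do rewrite big_cons.
apply: cD IHms; apply: (cM _ _); first exact: cst_continuous.
elim: (index_enum _) => [|i r IHr].
  by under eq_fun do rewrite big_nil; exact: cst_continuous.
under eq_fun do rewrite big_cons.
apply: (cM _ _ _ IHr); elim: (m i) => [|k IHk].
  by under eq_fun do rewrite expr0; exact: cst_continuous.
by under eq_fun do rewrite exprS; apply: (cM _ _ _ IHk); exact: coord_continuous.
Qed.

Definition sqdist (x y : 'cV[R]_n) : R := dotv (y - x) (y - x).

Lemma polyfun_sqdist x : polyfun (sqdist x).
Proof.
have p : polymap (fun y : 'cV[R]_n => y - x) by polymap_tac.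
by apply: polyfun_sum => i; exact: polyfunM.
Qed.

Lemma sqdist_continuous x : continuous (sqdist x).
Proof. exact/polyfun_continuous/polyfun_sqdist. Qed.

Lemma nbhs_sqdist_lt x y c : sqdist x y < c -> \forall z \near y, sqdist x z < c.
Proof. exact: (@cvgr_lt R _ (nbhs y) (nbhs_filter y) (sqdist x) _ (@sqdist_continuous x y)). Qed.

Lemma nbhs_sqdist_gt x y c : c < sqdist x y -> \forall z \near y, c < sqdist x z.
Proof. exact: (@cvgr_gt R _ (nbhs y) (nbhs_filter y) (sqdist x) _ (@sqdist_continuous x y)). Qed.

Lemma sqdist0 x : sqdist x x = 0.
Proof. by rewrite /sqdist subrr /dotv big1// => i _; rewrite !mxE mulr0. Qed.

(** Here [c > 0] is a squared radius: the function is 1 up to squared distance [c], 0 from [2 * c]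
    on, and polynomial in between. *)
Definition cutoff (x : 'cV[R]_n) (c : R) : 'cV[R]_n -> R :=
  cst 0 \max (cst 1 \min (fun y => 2 - sqdist x y / c)).

Lemma cutoff_continuous x c : continuous (cutoff x c).
Proof.
move=> y; apply: (@continuous_max R _ (cst 0)); first exact: cst_continuous.
apply: (@continuous_min R _ (cst 1)); first exact: cst_continuous.
apply: (@polyfun_continuous (fun y => 2 - sqdist x y / c)).
apply: polyfunB; first exact: polyfun_cst.
by apply: polyfunM; [exact: polyfun_sqdist|exact: polyfun_cst].
Qed.

(** A convex combination, equal to [g] near [x] and to [f] far away; it stays in the fibers because
    they are affine. *)
Definition glue (x : 'cV[R]_n) (c : R) f g (y : 'cV[R]_n) :=
  f y + cutoff x c y *: (g y - f y).

Lemma cutoff_inner x c y : 0 < c -> sqdist x y <= c -> cutoff x c y = 1.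
Proof.
move=> c0 yc; rewrite /cutoff/= min_l ?max_r//.
by rewrite lerBrDr -lerBrDl ler_pdivrMr//; lra.
Qed.

Lemma cutoff_outer x c y : 0 < c -> 2 * c <= sqdist x y -> cutoff x c y = 0.
Proof.
move=> c0 yc; rewrite /cutoff/= max_l// ge_min; apply/orP; right.
by rewrite subr_le0 ler_pdivlMr.
Qed.

Lemma cutoff_mid x c y : 0 < c -> c <= sqdist x y -> sqdist x y <= 2 * c ->
  cutoff x c y = 2 - sqdist x y / c.
Proof.
move=> c0 cy yc; rewrite /cutoff/= min_r ?max_r//.
  by rewrite subr_ge0 ler_pdivrMr.
by rewrite lerBlDr -lerBlDl ler_pdivlMr//; lra.
Qed.

Lemma glue_inner x c f g y : 0 < c -> sqdist x y <= c -> glue x c f g y = g y.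
Proof. by move=> c0 yc; rewrite /glue cutoff_inner// scale1r addrC subrK. Qed.

Lemma glue_outer x c f g y : 0 < c -> 2 * c <= sqdist x y -> glue x c f g y = f y.
Proof. by move=> c0 yc; rewrite /glue cutoff_outer// scale0r addr0. Qed.

Lemma glue_solution r Q (A : 'cV[R]_n -> 'M[R]_(r, s)) gamma x c f g :
  solution Q A gamma f -> solution Q A gamma g ->
  solution Q A gamma (glue x c f g).
Proof.
move=> fs gs y Qy; rewrite /glue mulmxDr -scalemxAr mulmxBr fs// gs//.
by rewrite subrr scaler0 addr0.
Qed.

Lemma semialgebraic_glue Q x c f g : 0 < c ->
  semialgebraic_fun Q f -> semialgebraic_fun Q g ->
  semialgebraic_fun Q (glue x c f g).
Proof.
move=> c0 sf sg; apply/semialgebraic_funP.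
(* The three clauses are the three regimes of the cutoff; in each, the value is polynomial in [a],
   [b] and the point. *)
rewrite (_ : mkset _ = [set z : 'cV[R]_(n + s) | exists a : 'cV[R]_s, exists b : 'cV[R]_s,
  ((Q (usubmx z) /\ f (usubmx z) = a) /\ (Q (usubmx z) /\ g (usubmx z) = b)) /\
  ((sqdist x (usubmx z) <= c -> b = dsubmx z) /\
   ((2 * c <= sqdist x (usubmx z) -> a = dsubmx z) /\
    (c < sqdist x (usubmx z) -> sqdist x (usubmx z) < 2 * c ->
     forall i, a i 0 + (2 - sqdist x (usubmx z) / c) * (b i 0 - a i 0) =
       dsubmx z i 0)))]).
  have pq m (h : 'cV[R]_m -> 'cV[R]_n) : polymap h -> polyfun (fun z => sqdist x (h z)).
    by move=> ph; apply: (polyfun_comp ph (polyfun_sqdist x)).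
  have pu m a b (h : 'cV[R]_m -> 'cV[R]_(a + b)) i : polymap h ->
    polyfun (fun z => usubmx (h z) i 0) by move=> ph; exact: (polymap_usub ph i).
  have pd m a b (h : 'cV[R]_m -> 'cV[R]_(a + b)) i : polymap h ->
    polyfun (fun z => dsubmx (h z) i 0) by move=> ph; exact: (polymap_dsub ph i).
  apply: semialgebraic_ex; apply: semialgebraic_ex; apply: semialgebraic_and.
    by apply: semialgebraic_and; [apply: (semialgebraic_graph sf)|
      apply: (semialgebraic_graph sg)]; polymap_tac.
  apply: semialgebraic_and.
    apply: semialgebraic_imply; last by apply: semialgebraic_eqv; polymap_tac.
    by apply: semialgebraic_le; [apply: pq; polymap_tac|exact: polyfun_cst].
  apply: semialgebraic_and.
    apply: semialgebraic_imply; last by apply: semialgebraic_eqv; polymap_tac.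
    by apply: semialgebraic_le; [exact: polyfun_cst|apply: pq; polymap_tac].
  apply: semialgebraic_imply.
    by apply: semialgebraic_lt; [exact: polyfun_cst|apply: pq; polymap_tac].
  apply: semialgebraic_imply.
    by apply: semialgebraic_lt; [apply: pq; polymap_tac|exact: polyfun_cst].
  apply: semialgebraic_forall_ord => i; apply: semialgebraic_eq.
    apply: polyfunD; first by apply: pd; polymap_tac.
    apply: polyfunM.
      apply: polyfunB; first exact: polyfun_cst.
      by apply: polyfunM; [apply: pq; polymap_tac|exact: polyfun_cst].
    by apply: polyfunB; apply: pd; polymap_tac.
  by apply: pd; polymap_tac.
apply/seteqP; split=> z /=.
  move=> [Qz <-]; exists (f (usubmx z)), (g (usubmx z)); split=> //.
  split; first by move=> zc; rewrite glue_inner.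
  split; first by move=> zc; rewrite glue_outer.
  by move=> cz zc i; rewrite /glue cutoff_mid ?ltW// !mxE.
move=> [a [b [[[Qz <-] [_ <-]] [inn [out mid]]]]]; split=> //.
have [zc|cz] := leP (sqdist x (usubmx z)) c; first by rewrite glue_inner// inn.
have [zc|cz'] := leP (2 * c) (sqdist x (usubmx z)); first by rewrite glue_outer// out.
by apply/colP => i; rewrite -mid// /glue cutoff_mid ?ltW// !mxE.
Qed.

(** Around [y] the glued map coincides with [g], so discontinuities of [f] there disappear. *)
Lemma glue_cvg_inner Q x c f g (y : 'cV[R]_n) : 0 < c -> sqdist x y < c ->
  g @ within Q (nbhs y) --> g y -> glue x c f g @ within Q (nbhs y) --> glue x c f g y.
Proof.
move=> c0 yc gy; rewrite glue_inner ?ltW//; apply: cvg_trans gy; apply: near_eq_cvg.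
rewrite near_withinE; near=> z => _; rewrite glue_inner//; apply: ltW; near: z.
exact: nbhs_sqdist_lt.
Unshelve. all: by end_near. Qed.

(** Gluing preserves continuity already achieved by [f]: beyond squared distance [2 * c] the map is
    [f], and elsewhere [g] is continuous too. *)
Lemma glue_cvg Q x c f g (y : 'cV[R]_n) : 0 < c ->
  f @ within Q (nbhs y) --> f y ->
  (sqdist x y <= 2 * c -> g @ within Q (nbhs y) --> g y) ->
  glue x c f g @ within Q (nbhs y) --> glue x c f g y.
Proof.
move=> c0 fy gy; have [/gy{}gy|yc] := leP (sqdist x y) (2 * c).
  apply: cvgD => //; apply: cvgZ; last exact: cvgB.
  exact: (@cvg_within_filter _ _ _ (nbhs y) (nbhs_filter y) _ _ (@cutoff_continuous x c y)).
rewrite glue_outer ?ltW//; apply: cvg_trans fy; apply: near_eq_cvg.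
rewrite near_withinE; near=> z => _; rewrite glue_outer//; apply: ltW; near: z.
exact: nbhs_sqdist_gt.
Unshelve. all: by end_near. Qed.

End Gluing.

(** * From Glaeser-stable fibers to a global continuous solution *)

Section Glaeser.
Context {R : realType} {n r s : nat}.
Variables (Q : set 'cV[R]_n) (A : 'cV[R]_n -> 'M[R]_(r, s))
  (gamma : 'cV[R]_n -> 'cV[R]_r).

Lemma glaeser_iter_sub (H : 'cV[R]_n -> set 'cV[R]_s) k y :
  glaeser_iter Q H k y `<=` H y.
Proof. by elim: k => [//|k IHk] v [/IHk]. Qed.

(** A stable fiber equals its own refinement, so [v] is a limit of points of nearby stable fibers,
    which lie in the original ones. *)
Lemma glaeser_stable_near (H : 'cV[R]_n -> set 'cV[R]_s) x v : Q x ->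
  glaeser_stable Q H x v ->
  H x v /\ forall e : R, 0 < e ->
    \forall y \near within Q (nbhs x), exists2 w, H y w & enorm (v - w) < e.
Proof.
move=> Qx [k [stab Hkv]]; split; first exact: glaeser_iter_sub Hkv.
(* Reading [v] in the fiber of step [k.+1] exposes the limit condition on the fibers of step [k]. *)
have := Hkv; rewrite -(stab k.+1) // => -[_ dist0] e e0.
have /dist0 : nbhs 0%E [set z : \bar R | (z < e%:E)%E].
  by apply: open_nbhs_nbhs; split; [exact: open_ereal_lt_ereal|rewrite /= lte_fin].
apply: (@filterS _ _ (within_filter Q (nbhs_filter x))) => y /ereal_inf_lt[_ [w /glaeser_iter_sub Hw <-]].
by rewrite lte_fin; exists w.
Qed.

(** The projection fixes [v] at [x], and at [y] it is at least as close to [v] as the fiber points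
    provided by stability. *)
Lemma fiber_proj_cvg x v : Q x -> glaeser_stable Q (system_bundle A gamma) x v ->
  fiber_proj A gamma v @ within Q (nbhs x) --> fiber_proj A gamma v x.
Proof.
move=> Qx /(glaeser_stable_near Qx)[Axv near_v].
have -> : fiber_proj A gamma v x = v.
  by apply: fiber_projE => //; rewrite subrr => u _; rewrite big1// => i _; rewrite mxE mulr0.
apply/cvg_within_colP => e /near_v; rewrite near_withinE => /nbhs_colP[d d0 dP].
exists d => // y Qy /dP /(_ Qy)[w Aw vw] j; apply: le_lt_trans vw.
apply: le_trans (fiber_proj_le v Aw).
by have := coord_le_enorm (v - fiber_proj A gamma v y) j; rewrite !mxE.
Qed.

(** Near [x] the only possible discontinuity is [x] itself, since the discontinuity set is
    semialgebraic with isolated points; stability gives continuity at [x]. *)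
Lemma fiber_proj_near_cvg x v rv : Q x ->
  glaeser_stable Q (system_bundle A gamma) x v ->
  semialgebraic_radius Q A gamma x v rv ->
  discontinuous_at_most_at_isolated_points (eball Q x rv) (fiber_proj A gamma v) ->
  \forall y \near x, Q y ->
    fiber_proj A gamma v @ within Q (nbhs y) --> fiber_proj A gamma v y.
Proof.
move=> Qx stab [rv0 sv] disc; pose f := fiber_proj A gamma v.
have nearD := semialgebraic_isolated_near x (semialgebraic_discontinuities sv) disc.
have ballx : \forall y \near x, sqdist x y < rv ^+ 2.
  by apply: nbhs_sqdist_lt; rewrite sqdist0 exprn_gt0.
near=> y => Qy.
have [->|/eqP yx] := eqVneq y x; first exact: fiber_proj_cvg.
have xy : sqdist x y < rv ^+ 2 by near: y.
have By : eball Q x rv y by split=> //; rewrite enorm_lt.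
have fy : f @ within (eball Q x rv) (nbhs y) --> f y.
  apply: contrapT => nfy; apply: yx; suff : discontinuities (eball Q x rv) f y by near: y.
  by split.
(* The ball is open in [Q], so near [y] it contains all of [Q]. *)
apply: cvg_within_near fy; apply/nbhs_colP.
have /nbhs_colP[d d0 dP] := nbhs_sqdist_lt xy.
by exists d => // z /dP xz Qz; split=> //; rewrite enorm_lt.
Unshelve. all: by end_near. Qed.

(** Induction on the centers: each gluing gains continuity on a new inner ball and keeps it on the
    earlier ones. The initial [phi0] may be discontinuous. *)
Lemma exists_glued_solution (phi0 : 'cV[R]_n -> 'cV[R]_s)
    (g : 'cV[R]_n -> 'cV[R]_n -> 'cV[R]_s) (c : 'cV[R]_n -> R) (X : seq 'cV[R]_n) :
  solution Q A gamma phi0 -> semialgebraic_fun Q phi0 ->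
  (forall x, x \in X -> [/\ 0 < c x, solution Q A gamma (g x), semialgebraic_fun Q (g x) &
    forall y, Q y -> sqdist x y <= 2 * c x -> g x @ within Q (nbhs y) --> g x y]) ->
  exists phi, [/\ solution Q A gamma phi, semialgebraic_fun Q phi &
    forall x y, x \in X -> Q y -> sqdist x y < c x ->
      phi @ within Q (nbhs y) --> phi y].
Proof.
move=> sol0 semi0; elim: X => [_|x X IHX gX].
  by exists phi0; split.
have [z zX|f [solf semif fX]] := IHX; first by apply: gX; rewrite inE zX orbT.
have [c0 solg semig gc] := gX x (mem_head _ _).
exists (glue x (c x) f (g x)); split; first exact: glue_solution.
  exact: semialgebraic_glue.
move=> z y; rewrite inE => /predU1P[->|zX] Qy zy.
  by apply: glue_cvg_inner => //; apply: gc => //; lra.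
by apply: glue_cvg => //; [exact: fX zy|exact: gc].
Qed.

Lemma exists_continuous_semialgebraic_solution (phi1 : 'cV[R]_n -> 'cV[R]_s) :
  compact Q -> semialgebraic_mxfun Q A -> semialgebraic_fun Q gamma ->
  solution Q A gamma phi1 ->
  (forall x, Q x -> exists v, \forall y \near x, Q y ->
    fiber_proj A gamma v @ within Q (nbhs y) --> fiber_proj A gamma v y) ->
  exists phi, [/\ solution Q A gamma phi,
    {within Q, continuous phi} & semialgebraic_fun Q phi].
Proof.
move=> Qcompact sA sg sol1 loc.
have solv v : solution Q A gamma (fiber_proj A gamma v).
  by move=> x Qx; have [] := fiber_projP v (sol1 _ Qx).
have semiv v : semialgebraic_fun Q (fiber_proj A gamma v).
  exact: semialgebraic_fiber_proj sol1.
have /choice[w wP] : forall x : 'cV[R]_n, exists w : 'cV[R]_s * R, Q x -> 0 < w.2 /\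
    forall y, Q y -> sqdist x y <= 2 * w.2 ->
      fiber_proj A gamma w.1 @ within Q (nbhs y) --> fiber_proj A gamma w.1 y.
  move=> x; have [Qx|nQx] := pselect (Q x); last by exists (0, 0) => /nQx.
  have [v /nbhs_colP[d d0 dP]] := loc x Qx.
  (* With this squared radius, the cutoff support has squared distance at most [d ^+ 2 / 2], so
     every coordinate stays within [d]. *)
  exists (v, d ^+ 2 / 4) => _ /=; split; first by rewrite divr_gt0 ?exprn_gt0.
  move=> y Qy xy; apply: dP => // i; rewrite -ltr_sqr ?nnegrE ?(ltW d0)//.
  have := sqr_coord_le (y - x) i; rewrite !mxE real_normK ?num_real// -sqrrN opprB => yx.
  have d2 : 0 < d ^+ 2 by rewrite exprn_gt0.
  by apply: le_lt_trans yx _; apply: le_lt_trans xy _; lra.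
(* The inner balls, where the cutoff is 1, must cover [Q]: only there does a gluing repair the
   map. *)
move: (Qcompact); rewrite compact_cover => /(_ _ Q (fun x => [set y | sqdist x y < (w x).2])).
case=> [x Qx|x Qx|X XQ QX].
- by rewrite openE => y; exact: nbhs_sqdist_lt.
- by exists x => //; rewrite /= sqdist0; have [] := wP _ Qx.
have [//|//|x xX|phi [solphi semiphi phiX]] := @exists_glued_solution
  (fiber_proj A gamma 0) (fun x => fiber_proj A gamma (w x).1) (fun x => (w x).2)
  (finmap.enum_fset X).
  by have [] := wP x (set_mem (XQ _ xX)).
exists phi; split=> //; apply/subspace_continuousP => y Qy.
by have [x xX xy] := QX _ Qy; exact: phiX xX Qy xy.
Qed.

End Glaeser.

(** * Equivalence of the four solvability conditions *)

Theorem theorem3p3 (R : realType) (n r s : nat) (Q : set 'cV[R]_n)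
  (A : 'cV[R]_n -> 'M[R]_(r, s)) (gamma : 'cV[R]_n -> 'cV[R]_r)
  (phi1 p : 'cV[R]_n -> 'cV[R]_s)
  (Qcompact : compact Q)
  (Acont : {within Q, continuous A})
  (Asemialg : semialgebraic_mxfun Q A)
  (gammacont : {within Q, continuous gamma})
  (gammasemialg : semialgebraic_fun Q gamma)
  (phi1sol : solution Q A gamma phi1)
  (pE : forall x, Q x -> p x = closest_point (ker_orth (A x)) (phi1 x))
  (disc : forall x, Q x ->
     exists v, semialgebraic_glaeser_stable Q A gamma x v /\
     exists rv, semialgebraic_radius Q A gamma x v rv /\
       discontinuous_at_most_at_isolated_points
         (eball Q x rv) (fiber_proj A gamma v)) :
  [<-> (exists phi, [/\ solution Q A gamma phi,
                        {within Q, continuous phi} & semialgebraic_fun Q phi]);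
       (forall x, Q x -> semialgebraic_glaeser_stable Q A gamma x !=set0);
       (forall x, Q x -> glaeser_stable Q (system_bundle A gamma) x !=set0) /\
         semialgebraic_fun Q p;
       (exists phi, solution Q A gamma phi /\ {within Q, continuous phi}) /\
         (exists psi, solution Q A gamma psi /\ semialgebraic_fun Q psi)].
Proof.
have [phi [solphi contphi semiphi]] : exists phi, [/\ solution Q A gamma phi,
    {within Q, continuous phi} & semialgebraic_fun Q phi].
  apply: exists_continuous_semialgebraic_solution phi1sol _ => // x Qx.
  have [v [[stab _] [rv [srv dv]]]] := disc _ Qx.
  by exists v; exact: fiber_proj_near_cvg Qx stab srv dv.
tfae.
- by move=> _ x /disc[v [sv _]]; exists v.
- move=> ne; split; first by move=> x /ne[v [sv _]]; exists v.
  (* On [Q] the map [p] agrees with the projection of 0 onto the fibers, so both have the same graph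
     over [Q]. *)
  have := semialgebraic_fiber_proj 0 Asemialg gammasemialg phi1sol.
  rewrite /semialgebraic_fun; congr semialgebraic; apply: eq_imagel => x Qx.
  by rewrite pE// (closest_point_ker_orth (phi1sol _ Qx)).
- by move=> _; split; exists phi.
- by move=> _; exists phi.
Qed.
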